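(* Let $n\ge 2$, let $\boldsymbol{X}$ be a nonnegative $n$-dimensional random vector with mean vector $\boldsymbol{\mu}=(\mu_1,\ldots,\mu_n)^\top$ and positive definite covariance matrix $\boldsymbol{\Sigma}$. Let $\underline{\boldsymbol{\mu}}:=(\min_{1\le j\le n}\mu_j)\boldsymbol{1}$ and $\overline{\boldsymbol{\mu}}:=(\max_{1\le j\le n}\mu_j)\boldsymbol{1}$. Define $$ c_0:=\min_{1\le j\le n}(\boldsymbol{\Sigma}^{-1}\boldsymbol{\mu})_j\quad\text{and}\quad c_1:=\max_{1\le j\le n}(\boldsymbol{\Sigma}^{-1}\boldsymbol{\mu})_j. $$ Then all the entries of the matrix $$ \boldsymbol{A}_*=\frac{1}{n}\boldsymbol{1}\boldsymbol{1}^\top+\frac{1}{a}\left(\boldsymbol{I}-\frac{1}{n}\boldsymbol{1}\boldsymbol{1}^\top\right)\boldsymbol{\mu}\boldsymbol{\mu}^\top\boldsymbol{\Sigma}^{-1},\qquad a=\boldsymbol{\mu}^\top\boldsymbol{\Sigma}^{-1}\boldsymbol{\mu}, $$ are nonnegative if and only if $$ \max\left\{-c_0\|\boldsymbol{\mu}-\overline{\boldsymbol{\mu}}\|_1,\ c_1\|\boldsymbol{\mu}-\underline{\boldsymbol{\mu}}\|_1\right\}\le\boldsymbol{\mu}^\top\boldsymbol{\Sigma}^{-1}\boldsymbol{\mu}. $$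
   Context: $\boldsymbol{1}$ is the $n$-dimensional column vector of ones, $\boldsymbol{I}$ the $n\times n$ identity matrix, and $\|\cdot\|_1$ the $\ell^1$ vector norm. $\boldsymbol{\mu}=\mathbb{E}[\boldsymbol{X}]$ and $\boldsymbol{\Sigma}=\mathbb{E}[(\boldsymbol{X}-\boldsymbol{\mu})(\boldsymbol{X}-\boldsymbol{\mu})^\top]$. Since $\boldsymbol{X}$ is entrywise nonnegative and $\boldsymbol{\Sigma}$ is positive definite, all $\mu_j>0$. The matrix $\boldsymbol{A}_*$ is the unique minimizer of $\frac12\operatorname{tr}(\boldsymbol{A}\boldsymbol{\Sigma}\boldsymbol{A}^\top)$ over $\boldsymbol{A}\in\mathbb{R}^{n\times n}$ subject to $\boldsymbol{1}^\top\boldsymbol{A}=\boldsymbol{1}^\top$ and $\boldsymbol{A}\boldsymbol{\mu}=\boldsymbol{\mu}$ (the complete-graph case). *)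

(* Defs.v *)
From HB Require Import structures.
From mathcomp Require Import all_boot all_order all_algebra.
From mathcomp Require Import all_classical all_reals all_analysis.
Set Implicit Arguments.
Unset Strict Implicit.
Unset Printing Implicit Defensive.
Import Order.TTheory GRing.Theory Num.Theory.
Local Open Scope ring_scope.

(* [fine] sends infinite values to 0; it is harmless here because the mean
   and the covariance are only used for square-integrable components. *)
Definition mean_vec (R : realType) (d : measure_display)
    (T : measurableType d) (P : probability T R) (n : nat)
    (X : 'I_n -> {RV P >-> R}) : 'cV[R]_n :=
  \col_i fine ('E_P[X i])%E.

Definition cov_mx (R : realType) (d : measure_display)
    (T : measurableType d) (P : probability T R) (n : nat)
    (X : 'I_n -> {RV P >-> R}) : 'M[R]_n :=
  \matrix_(i, j) fine (covariance P (X i) (X j)).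

Definition posdef_mx (R : realType) (n : nat) (S : 'M[R]_n) : Prop :=
  S^T = S /\ forall x : 'cV[R]_n, x != 0 -> 0 < (x^T *m S *m x) 0 0.

Definition ones (R : realType) (n : nat) : 'cV[R]_n := const_mx 1.
Arguments ones {R n}.

Definition norm_l1 (R : realType) (n : nat) (v : 'cV[R]_n) : R :=
  \sum_i `|v i 0|.

(* The start value of each iterated operation is the first entry of the
   vector, so these are the minimum and the maximum of the entries alone. *)
Definition vmin (R : realType) (n : nat) (n_gt0 : (0 < n)%N)
    (v : 'cV[R]_n) : R :=
  \big[Num.min/v (Ordinal n_gt0) 0]_i v i 0.

Definition vmax (R : realType) (n : nat) (n_gt0 : (0 < n)%N)
    (v : 'cV[R]_n) : R :=
  \big[Num.max/v (Ordinal n_gt0) 0]_i v i 0.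

Definition feasible (R : realType) (n : nat) (mu : 'cV[R]_n)
    (A : 'M[R]_n) : Prop :=
  (ones : 'cV[R]_n)^T *m A = ones^T /\ A *m mu = mu.

Definition objective (R : realType) (n : nat) (Sigma A : 'M[R]_n) : R :=
  2^-1 * \tr (A *m Sigma *m A^T).

Definition is_minimizer (R : realType) (n : nat) (Sigma : 'M[R]_n)
    (mu : 'cV[R]_n) (A : 'M[R]_n) : Prop :=
  feasible mu A /\
  forall B : 'M[R]_n, feasible mu B -> objective Sigma A <= objective Sigma B.

Definition quad_inv (R : realType) (n : nat) (Sigma : 'M[R]_n)
    (mu : 'cV[R]_n) : R :=
  (mu^T *m invmx Sigma *m mu) 0 0.

Definition A_star (R : realType) (n : nat) (Sigma : 'M[R]_n)
    (mu : 'cV[R]_n) : 'M[R]_n :=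
  let J : 'M[R]_n := n%:R^-1 *: (ones *m ones^T) in
  J + (quad_inv Sigma mu)^-1 *: ((1%:M - J) *m mu *m mu^T *m invmx Sigma).

(* Main.v *)
Require Import Defs.
From HB Require Import structures.
From mathcomp Require Import all_boot all_order all_algebra.
From mathcomp Require Import all_classical all_reals all_analysis.
From mathcomp Require Import measurable_realfun ring lra.

Import Order.TTheory GRing.Theory Num.Theory.
Local Open Scope ring_scope.

(** Write [w] for [Sigma^-1 mu], [a] for [mu^T Sigma^-1 mu] and [J] for the
    averaging matrix [n^-1 1 1^T].

    The mean vector is nonzero: a nonnegative variable of mean zero vanishes
    almost surely, so its variance is zero, which positive definiteness of
    [Sigma] excludes ([covariance_ge0_mean0]). Hence [a > 0] and [A_star]
    behaves as expected.

    Optimality is Pythagoras for the inner product [tr (A Sigma B^T)]. The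
    difference [D] of two feasible matrices satisfies [1^T D = 0] and
    [D mu = 0]. Both summands of [A_star] are orthogonal to every such [D]:
    [tr (D Sigma J)] is a multiple of [1^T D Sigma 1], and
    [D Sigma (K mu mu^T Sigma^-1)^T = D mu (K mu)^T] for any [K]. So the
    objective at a feasible [B] exceeds the one at [A_star] by half the squared
    norm of [B - A_star], which vanishes only at [B = A_star]
    ([A_star_unique_minimizer]).

    For the signs, the entry [(i, j)] of [A_star] is
    [(a + x_i w_j) / (n a)] with [x_i = n mu_i - sum_k mu_k] ([A_starE]). The
    [x_i] sum to zero, so their maximum is nonnegative and their minimum is
    nonpositive; these extreme values are the l1 distance from [mu] to its
    constant upper bound and minus the l1 distance to its constant lower
    bound. A product [x w] over a box whose [x]-side contains 0 is either
    nonnegative or bounded below by one of the corners (max x, min w) and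
    (min x, max w), so only those two corners have to be tested against [-a];
    they give the two terms of the maximum ([A_star_ge0P]). *)

(** An almost surely nonnegative variable of mean zero is almost surely zero,
    hence uncorrelated with everything. Taking [Y := X], its variance is zero. *)
Lemma covariance_ge0_mean0 {R : realType} {d : measure_display}
    {T : measurableType d} (P : probability T R) (X Y : {RV P >-> R}) :
  {ae P, forall w, 0 <= X w} -> (X : T -> R) \in Lfun P 1 ->
  fine ('E_P[X])%E = 0 -> covariance P X Y = 0%E.
Proof.
move=> X_ge0 X_L1 EX0.
have mX : measurable_fun setT (EFin \o X : T -> \bar R) by apply/measurable_EFinP.
have intX : (\int[P]_w (X w)%:E = 0)%E.
  have := expectation_fin_num X_L1.
  by rewrite unlock => /fineK <-; move: EX0; rewrite unlock => ->.
have X_eq0 : ae_eq P setT (fun w => (X w)%:E) (cst 0%E).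
  apply/ae_eq_integral_abs => //; rewrite -intX.
  apply: ae_eq_integral => //; first exact: measurableT_comp.
  by apply: filterS X_ge0 => w Xw _ /=; rewrite ger0_norm.
rewrite unlock EX0 unlock.
rewrite (ae_eq_integral (cst 0%E)) ?integral0 //.
  apply/measurable_EFinP; apply: measurable_funM;
    by apply: measurable_funB.
apply: filterS X_eq0 => w Xw _ /=; have [Xw0] := Xw I.
by rewrite mulrfctE /= Xw0 subr0 mul0r.
Qed.

Section PosDef.
Context {R : realType} {n : nat}.
Implicit Types (S A B : 'M[R]_n) (mu v : 'cV[R]_n).

(** A nonzero kernel vector of [S] would be a zero of its quadratic form. *)
Lemma posdef_unitmx S : posdef_mx S -> S \in unitmx.
Proof.
move=> [_ S_gt0]; rewrite -row_free_unit -kermx_eq0.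
apply/negPn/negP => /rowV0Pn[v /sub_kermxP vS0 v_neq0].
have /S_gt0 : v^T != 0 by rewrite trmx_eq0.
by rewrite trmxK vS0 mul0mx mxE ltxx.
Qed.

(** The form of [S^-1] at [mu] is the form of [S] at [S^-1 mu]. *)
Lemma quad_inv_gt0 S mu : posdef_mx S -> mu != 0 -> 0 < quad_inv S mu.
Proof.
move=> S_pd mu_neq0; have Su := posdef_unitmx S S_pd.
have [S_sym S_gt0] := S_pd.
have /S_gt0 : invmx S *m mu != 0.
  apply: contra_neq mu_neq0 => w0.
  by rewrite -[mu](mulKVmx Su) w0 mulmx0.
by rewrite trmx_mul trmx_inv S_sym -!mulmxA mulKVmx // mulmxA.
Qed.

(** Splits the squared norm of a matrix for [S] into those of its rows, which
    reduces definiteness on matrices to [posdef_mx]. *)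
Lemma mxtrace_quadE S A :
  \tr (A *m S *m A^T) = \sum_i ((row i A)^T^T *m S *m (row i A)^T) 0 0.
Proof.
apply: eq_bigr => i _; rewrite trmxK -row_mul !mxE.
by apply: eq_bigr => j _; rewrite !mxE.
Qed.

Lemma posdef_ge0 S v : posdef_mx S -> 0 <= (v^T *m S *m v) 0 0.
Proof.
move=> [_ S_gt0]; have [->|/S_gt0/ltW//] := eqVneq v 0.
by rewrite mulmx0 mxE.
Qed.

Lemma mxtrace_quad_ge0 S A : posdef_mx S -> 0 <= \tr (A *m S *m A^T).
Proof.
by move=> S_pd; rewrite mxtrace_quadE sumr_ge0 // => i _; apply: posdef_ge0.
Qed.

Lemma mxtrace_quad_le0 S A : posdef_mx S -> \tr (A *m S *m A^T) <= 0 -> A = 0.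
Proof.
move=> S_pd tr_le0; have [_ S_gt0] := S_pd.
have : \tr (A *m S *m A^T) == 0 by rewrite eq_le tr_le0 mxtrace_quad_ge0.
rewrite mxtrace_quadE psumr_eq0 => [/allP q0|i _]; last exact: posdef_ge0.
apply/row_matrixP => i; rewrite row0.
apply/eqP; rewrite -trmx_eq0; apply: contraT => /S_gt0.
by have /eqP -> := q0 i (mem_index_enum i); rewrite ltxx.
Qed.

Context (n_gt0 : (0 < n)%N).

Definition averaging_mx : 'M[R]_n := n%:R^-1 *: (ones *m ones^T).
Local Notation J := averaging_mx.

Lemma ones_averaging_mx : (ones : 'cV[R]_n)^T *m J = ones^T.
Proof.
have nn0 : n%:R != 0 :> R by rewrite pnatr_eq0 -lt0n.
rewrite -scalemxAr mulmxA [_^T *m _]mx11_scalar mul_scalar_mx scalerA.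
rewrite mxE (eq_bigr (fun=> 1)) ?sumr_const ?card_ord ?mulVf ?scale1r //.
by move=> i _; rewrite !mxE mulr1.
Qed.

Lemma A_star_feasible S mu : posdef_mx S -> mu != 0 ->
  feasible mu (A_star S mu).
Proof.
move=> S_pd mu_neq0; have a_neq0 := lt0r_neq0 (quad_inv_gt0 S mu S_pd mu_neq0).
rewrite /feasible /A_star -/J; split.
  rewrite mulmxDr ones_averaging_mx -scalemxAr !mulmxA mulmxBr ones_averaging_mx mulmx1.
  by rewrite subrr !mul0mx scaler0 addr0.
(* The rank-one part acts on [mu] as [K]: the factor mu^T S^-1 mu cancels. *)
have rank1_mu (K : 'M[R]_n) : (quad_inv S mu)^-1 *:
    (K *m mu *m mu^T *m invmx S) *m mu = K *m mu.
  rewrite -scalemxAl -!mulmxA [mu^T *m _]mx11_scalar.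
  rewrite [mu^T *m _]mulmxA -/(quad_inv S mu) mul_mx_scalar -scalemxAr scalerA.
  by rewrite mulVf // scale1r.
by rewrite [LHS]mulmxDl rank1_mu mulmxBl mul1mx addrC subrK.
Qed.

(** The difference [D] of two feasible matrices is a direction in which the
    objective is stationary at [A_star]. *)
Lemma A_star_orthogonal S mu D : posdef_mx S ->
  (ones : 'cV[R]_n)^T *m D = 0 -> D *m mu = 0 ->
  \tr (D *m S *m (A_star S mu)^T) = 0.
Proof.
move=> S_pd oneD Dmu; have Su := posdef_unitmx S S_pd.
have [S_sym _] := S_pd.
(* Cycling the trace turns [D S 1 1^T] into [1^T D S 1]. *)
have tr_J : \tr (D *m S *m J^T) = 0.
  rewrite /averaging_mx linearZ /= trmx_mul trmxK -scalemxAr linearZ /=.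
  by rewrite mulmxA mxtrace_mulC !mulmxA oneD !mul0mx mxtrace0 mulr0.
(* Transposing cancels [S S^-1] and leaves the factor [D mu]. *)
have tr_rank1 (c : R) (K : 'M[R]_n) :
    \tr (D *m S *m (c *: (K *m mu *m mu^T *m invmx S))^T) = 0.
  rewrite linearZ /= !trmx_mul trmxK trmx_inv S_sym -scalemxAr -!mulmxA.
  by rewrite mulKVmx // [D *m _]mulmxA Dmu mul0mx scaler0 mxtrace0.
by rewrite /A_star -/J [_^T]linearD mulmxDr mxtraceD tr_J tr_rank1 addr0.
Qed.

Lemma objective_pythagoras S A B : S^T = S -> \tr ((B - A) *m S *m A^T) = 0 ->
  objective S B = objective S A + 2^-1 * \tr ((B - A) *m S *m (B - A)^T).
Proof.
move=> S_sym cross.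
have cross' : \tr (A *m S *m (B - A)^T) = 0.
  by rewrite -mxtrace_tr !trmx_mul trmxK S_sym mulmxA.
rewrite /objective -mulrDr; congr (_ * _).
rewrite -{1 2}[B](subrK A); move: (B - A : 'M[R]_n) cross cross' => D cross cross'.
have -> : (D + A)^T = D^T + A^T by rewrite linearD.
rewrite mulmxDl mulmxDr !mulmxDl !mxtraceD.
by rewrite cross cross' addr0 add0r addrC.
Qed.

Lemma A_star_unique_minimizer S mu : posdef_mx S -> mu != 0 ->
  unique (is_minimizer S mu) (A_star S mu).
Proof.
move=> S_pd mu_neq0; set A := A_star S mu.
have [A1 A2] : feasible mu A by exact: A_star_feasible.
have objE B : feasible mu B ->
    objective S B = objective S A + 2^-1 * \tr ((B - A) *m S *m (B - A)^T).
  move=> [B1 B2]; have [S_sym _] := S_pd.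
  have cross : \tr ((B - A) *m S *m A^T) = 0.
    by apply: A_star_orthogonal; rewrite ?mulmxBr ?mulmxBl ?A1 ?B1 ?A2 ?B2 ?subrr.
  exact: objective_pythagoras.
split; first split=> // B /objE ->.
  by rewrite lerDl mulr_ge0 ?mxtrace_quad_ge0 // invr_ge0 ler0n.
move=> B [B_feas /(_ A (conj A1 A2))]; rewrite objE //.
rewrite gerDl pmulr_rle0 ?invr_gt0 ?ltr0n // => /(mxtrace_quad_le0 _ _ S_pd).
by move/eqP; rewrite subr_eq0 => /eqP.
Qed.

(** Clearing the denominators [n] and [a] puts the whole dependence on [i, j]
    into one product, whose first factor is bounded by the l1 distances
    of [norm_l1_sub_vmax] and [norm_l1_sub_vmin]. *)
Lemma A_starE S mu (i j : 'I_n) : posdef_mx S -> mu != 0 ->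
  A_star S mu i j = (n%:R * quad_inv S mu)^-1 *
    (quad_inv S mu + (n%:R * mu i 0 - \sum_k mu k 0) * (invmx S *m mu) j 0).
Proof.
move=> S_pd mu_neq0; have a_neq0 := lt0r_neq0 (quad_inv_gt0 S mu S_pd mu_neq0).
have nn0 : n%:R != 0 :> R by rewrite pnatr_eq0 -lt0n.
have [S_sym _] := S_pd.
have JE : J *m mu = const_mx (n%:R^-1 * \sum_k mu k 0).
  apply/matrixP => p q; rewrite -scalemxAl -mulmxA !mxE big_ord1 !mxE mul1r.
  by congr (_ * _); apply: eq_bigr => k _; rewrite !mxE mul1r (ord1 q).
have wE : mu^T *m invmx S = (invmx S *m mu)^T by rewrite trmx_mul trmx_inv S_sym.
have -> : A_star S mu i j =
    n%:R^-1 + (quad_inv S mu)^-1 *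
      ((mu i 0 - n%:R^-1 * \sum_k mu k 0) * (invmx S *m mu) j 0).
  rewrite /A_star -/J -(mulmxA _ mu^T) wE mulmxBl mul1mx JE mxE.
  congr (_ + _); first by rewrite !mxE big_ord1 !mxE !mulr1.
  by rewrite mxE mxE big_ord1 [(_^T) _ _]mxE; congr (_ * (_ * _)); rewrite !mxE.
by field; apply/andP.
Qed.

Lemma vmax_ge v (i : 'I_n) : v i 0 <= vmax n_gt0 v.
Proof. exact: (le_bigmax _ (fun k => v k 0)). Qed.

Lemma vmin_le v (i : 'I_n) : vmin n_gt0 v <= v i 0.
Proof. exact: (bigmin_le _ _ (fun k => v k 0)). Qed.

Lemma vmax_attained v : exists i, vmax n_gt0 v = v i 0.
Proof.
apply: (big_ind (fun x => exists i, x = v i 0)); first by eexists.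
  by move=> x y ? ?; rewrite maxEle; case: ifP.
by move=> i _; exists i.
Qed.

Lemma vmin_attained v : exists i, vmin n_gt0 v = v i 0.
Proof.
apply: (big_ind (fun x => exists i, x = v i 0)); first by eexists.
  by move=> x y ? ?; rewrite minEle; case: ifP.
by move=> i _; exists i.
Qed.

(** All entries of [v] lie on the same side of their maximum, so the absolute
    values drop and the l1 norm becomes linear. *)
Lemma norm_l1_sub_vmax v :
  norm_l1 (v - vmax n_gt0 v *: ones) = n%:R * vmax n_gt0 v - \sum_k v k 0.
Proof.
rewrite /norm_l1 (eq_bigr (fun k => vmax n_gt0 v - v k 0)) => [|k _].
  by rewrite sumrB sumr_const card_ord mulr_natl.
by rewrite !mxE mulr1 distrC ger0_norm // subr_ge0 vmax_ge.
Qed.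

Lemma norm_l1_sub_vmin v :
  norm_l1 (v - vmin n_gt0 v *: ones) = \sum_k v k 0 - n%:R * vmin n_gt0 v.
Proof.
rewrite /norm_l1 (eq_bigr (fun k => v k 0 - vmin n_gt0 v)) => [|k _].
  by rewrite sumrB sumr_const card_ord mulr_natl.
by rewrite !mxE mulr1 ger0_norm // subr_ge0 vmin_le.
Qed.

Lemma norm_l1_ge0 v : 0 <= norm_l1 v.
Proof. exact: sumr_ge0. Qed.

(** Necessity evaluates [A_starE] at the indices where the extrema are reached.
    Sufficiency is the box argument: for [x >= 0] the product [x w] decreases
    when [w] drops to its minimum, then, if that is negative, when [x] rises to
    its maximum; the case [x < 0] is symmetric. *)
Lemma A_star_ge0P S mu : posdef_mx S -> mu != 0 ->
  (forall i j, 0 <= A_star S mu i j) <->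
  Num.max (- vmin n_gt0 (invmx S *m mu) *
             norm_l1 (mu - vmax n_gt0 mu *: ones))
          (vmax n_gt0 (invmx S *m mu) *
             norm_l1 (mu - vmin n_gt0 mu *: ones))
    <= quad_inv S mu.
Proof.
move=> S_pd mu_neq0; have a_gt0 := quad_inv_gt0 S mu S_pd mu_neq0.
set w := invmx S *m mu; set a := quad_inv S mu in a_gt0 *.
have n_gt0R : 0 < n%:R :> R by rewrite ltr0n.
have A_ge0 i j : (0 <= A_star S mu i j) =
    (0 <= a + (n%:R * mu i 0 - \sum_k mu k 0) * w j 0).
  by rewrite A_starE // pmulr_rge0 // invr_gt0 mulr_gt0.
have hi := norm_l1_ge0 (mu - vmax n_gt0 mu *: ones).
have lo := norm_l1_ge0 (mu - vmin n_gt0 mu *: ones).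
rewrite ge_max norm_l1_sub_vmax norm_l1_sub_vmin in hi lo *.
split=> [Age0|/andP[up low] i j].
  have [iM muM] := vmax_attained mu; have [im mum] := vmin_attained mu.
  have [jM wM] := vmax_attained w; have [jm wm] := vmin_attained w.
  rewrite muM mum wM wm.
  have := Age0 iM jm; have := Age0 im jM; rewrite !A_ge0 => ? ?.
  apply/andP; split; lra.
rewrite A_ge0; set x := n%:R * mu i 0 - _.
have xM : x <= n%:R * vmax n_gt0 mu - \sum_k mu k 0.
  by rewrite lerD2r ler_pM2l // vmax_ge.
have xm : n%:R * vmin n_gt0 mu - \sum_k mu k 0 <= x.
  by rewrite lerD2r ler_pM2l // vmin_le.
have [x_ge0|x_lt0] := leP 0 x.
  have : x * vmin n_gt0 w <= x * w j 0 by rewrite ler_wpM2l // vmin_le.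
  have [w_ge0|w_lt0] := leP 0 (vmin n_gt0 w); first by nra.
  by have := ler_wnM2r (ltW w_lt0) xM; lra.
have : x * vmax n_gt0 w <= x * w j 0 by apply: ler_wnM2l; [exact: ltW | exact: vmax_ge].
have [w_ge0|w_lt0] := leP 0 (vmax n_gt0 w); last by nra.
by have := ler_wpM2r w_ge0 xm; lra.
Qed.

End PosDef.

Theorem proposition2p1 (R : realType) (d : measure_display)
  (T : measurableType d) (P : probability T R)
  (n : nat) (n_ge2 : (2 <= n)%N) (X : 'I_n -> {RV P >-> R})
  (X_ge0 : {ae P, forall w, forall i : 'I_n, 0 <= X i w})
  (X_L2 : forall i : 'I_n, (X i : T -> R) \in Lfun P 2%:E)
  (Sigma_pd : posdef_mx (cov_mx X)) :
  let mu := mean_vec X in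
  let Sigma := cov_mx X in
  let n_gt0 : (0 < n)%N := ltnW n_ge2 in
  let mu_low : 'cV[R]_n := vmin n_gt0 mu *: ones in
  let mu_up : 'cV[R]_n := vmax n_gt0 mu *: ones in
  let c0 := vmin n_gt0 (invmx Sigma *m mu) in
  let c1 := vmax n_gt0 (invmx Sigma *m mu) in
  unique (is_minimizer Sigma mu) (A_star Sigma mu) /\
  ((forall i j : 'I_n, 0 <= A_star Sigma mu i j) <->
   Num.max (- c0 * norm_l1 (mu - mu_up)) (c1 * norm_l1 (mu - mu_low))
     <= (mu^T *m invmx Sigma *m mu) 0 0).
Proof.
move=> mu Sigma n_gt0 mu_low mu_up c0 c1.
have mu_neq0 : mu != 0.
  (* If [mu = 0], then any variance, a value of the quadratic form of Sigma at
     a basis vector, would vanish. *)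
  apply/eqP => mu0; have i := Ordinal n_gt0.
  have e_neq0 : delta_mx i 0 != 0 :> 'cV[R]_n.
    by apply/eqP => /matrixP/(_ i 0)/eqP; rewrite !mxE !eqxx oner_eq0.
  have := Sigma_pd.2 _ e_neq0.
  rewrite trmx_delta -rowE -colE !mxE covariance_ge0_mean0 ?ltxx //.
  - by apply: filterS X_ge0 => w.
  - by apply: Lfun_subset12 (X_L2 i); exact: fin_num_measure.
  - by move/matrixP: mu0 => /(_ i 0); rewrite !mxE.
split; first exact: A_star_unique_minimizer.
exact: A_star_ge0P.
Qed.
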